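(* Consider the stochastic process (case 3) describing transmission of photons through a sequence of $M\ge 1$ identical polarization sensitive elements rotated by angles $\vec\alpha=(\alpha_0,\dots,\alpha_{M-1})$, with $N_0\neq 0$ initial photons and common transmission probability $P_T(\theta_{\mathrm{in}},\alpha)$, as defined in the context. Then for every $i\in(0,\dots,M-1)$, $$\frac{N_{i+1}(\vec\alpha)}{N_0}=\int_{\theta_i}\frac{N_i(\vec\alpha)}{N_0}\,\rho_{S,i}(\theta_i,\vec\alpha)\,P_T(\theta_i,\alpha_i)\,\mathrm{d}\theta_i .$$
   Context: Process ''case 3''. Photons pass successively through surfaces $\Sigma_0,\dots,\Sigma_M$; the $i$-th polarization sensitive element ($i=0,\dots,M-1$) lies between $\Sigma_i$ and $\Sigma_{i+1}$ and is rotated by a fixed (non-random) angle $\alpha_i$; $\vec\alpha=(\alpha_0,\dots,\alpha_{M-1})$. The state of a photon at $\Sigma_i$ is a random polarization angle $\theta_i$, ranging over a fixed interval of length $2\pi$ with Lebesgue measure $\mathrm{d}\theta_i$; $\int_{\theta_i}$ denotes integration over this interval. $N_0>0$ photons pass through $\Sigma_0$; different photons are independent. The data are: - $\rho_{S,0}(\theta_0,\vec\alpha)$: the probability density of $\theta_0$ (it does not depend on the element rotations). - $P_{T,i}(\theta_i,\alpha_i)\in[0,1]$, measurable: the conditional probability that a photon with polarization angle $\theta_i$ at $\Sigma_i$ is transmitted through the $i$-th element (otherwise it never reaches $\Sigma_{i+1},\dots,\Sigma_M$). - $\rho_{C,i}(\theta_i,\theta_{i+1},\alpha_i)\ge 0$,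 jointly measurable in $(\theta_i,\theta_{i+1})$, with $\int_{\theta_{i+1}}\rho_{C,i}(\theta_i,\theta_{i+1},\alpha_i)\,\mathrm{d}\theta_{i+1}=1$ for all $\theta_i$: the conditional probability density of the outgoing polarization angle $\theta_{i+1}$, given the incoming angle $\theta_i$ and given that the photon was transmitted through the $i$-th element. In case 3 it is assumed that (a) each $\rho_{C,i}$ does not depend on $\theta_i$, and (b) the elements are identical: there are functions $P_T(\theta_{\mathrm{in}},\alpha)$ and $\rho_C(\theta_{\mathrm{in}},\theta_{\mathrm{out}},\alpha)$ such that $P_{T,i}(\theta_i,\alpha_i)=P_T(\theta_i,\alpha_i)$ and $\rho_{C,i}(\theta_i,\theta_{i+1},\alpha_i)=\rho_C(\theta_i,\theta_{i+1},\alpha_i)$ for all $i=0,\dots,M-1$. Memoryless (Markov) property: transmission through the $i$-th element and the resulting angle depend on the past only through $\theta_i$. Derived quantities: $N_i(\vec\alpha)$ is the (expected) number of photons which pass through $\Sigma_i$, i.e. $N_0$ times the probability that a photon reaches $\Sigma_i$ (so $N_0(\vec\alpha)=N_0$); $\rho_{S,i}(\theta_i,\vec\alpha)$ is the probability density of the polarization angle at $\Sigma_i$ conditioned on the photon reaching $\Sigma_i$ (both depend on $\vec\alpha$ at most through $\alpha_0,\dots,\alpha_{i-1}$). If $N_i(\vec\alpha)=0$, the product $N_i(\vec\alpha)\rho_{S,i}(\theta_i,\vec\alpha)$ is understood to be $0$. *)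

(* Defs.v *)
From HB Require Import structures.
From mathcomp Require Import all_boot all_order all_algebra.
From mathcomp Require Import all_classical all_reals all_analysis.

Set Implicit Arguments.
Unset Strict Implicit.
Unset Printing Implicit Defensive.

Import Order.TTheory GRing.Theory Num.Theory.
Import numFieldNormedType.Exports.

Local Open Scope classical_set_scope.
Local Open Scope ring_scope.

(* Element i lies between the surfaces [front i] (Sigma_i) and [back i]
   (Sigma_(i+1)); the surfaces are numbered by 'I_M.+1. *)
Definition front (M : nat) (i : 'I_M) : 'I_M.+1 := widen_ord (leqnSn M) i.
Definition back (M : nat) (i : 'I_M) : 'I_M.+1 := lift ord0 i.

(* N0 photons observed on a common sample space whose probability law depends
   on the rotations. [angle k i w] is meaningful only for w in [reach k i]: a
   photon which has been stopped has no polarization angle, and every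
   condition below involves only angles at surfaces which are reached. *)
Record beam (R : realType) (M N0 : nat) (d : measure_display)
    (T : measurableType d) := Beam {
  law : ('I_M -> R) -> probability T R ;
  reach : 'I_N0 -> 'I_M.+1 -> set T ;
  angle : 'I_N0 -> 'I_M.+1 -> T -> R }.

Definition state_events (R : realType) (M N0 : nat) (d : measure_display)
    (T : measurableType d) (X : beam R M N0 T) (k : 'I_N0) (i : 'I_M.+1) :
    set_system T :=
  preimage_set_system (reach X k i) (angle X k i)
    (@measurable _ (measurableTypeR R)).

(* The sigma-algebra of the past of photon k up to surface i; it also records
   at which surfaces the photon was absent. *)
Definition history (R : realType) (M N0 : nat) (d : measure_display)
    (T : measurableType d) (X : beam R M N0 T) (k : 'I_N0) (i : 'I_M.+1) :
    set_system T :=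
  <<s \bigcup_(j in [set j : 'I_M.+1 | (j <= i)%N]) state_events X k j >>.

(* f is, on D, a version of the conditional probability of E given D and the
   events of G. *)
Definition is_cond_prob (R : realType) (d : measure_display)
    (T : measurableType d) (P : probability T R) (G : set_system T)
    (D E : set T) (f : T -> \bar R) : Prop :=
  forall A, G A -> P (A `&` D `&` E) = (\int[P]_(w in A `&` D) f w)%E.

(* On the surface i, rho is a probability density on J of the polarization
   angle of photon k conditioned on reaching i; if this has probability zero,
   rho is unconstrained. *)
Definition is_angle_density (R : realType) (M N0 : nat) (d : measure_display)
    (T : measurableType d) (X : beam R M N0 T) (J : set R) (a : 'I_M -> R)
    (k : 'I_N0) (i : 'I_M.+1) (rho : R -> R) : Prop :=
  law X a (reach X k i) != 0%E ->
  [/\ measurable_fun J rho,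
      forall x, J x -> 0 <= rho x &
      forall B : set R, measurable B ->
        (fine (law X a (reach X k i `&` angle X k i @^-1` B)) /
         fine (law X a (reach X k i)))%:E
        = (\int[lebesgue_measure]_(x in J `&` B) (rho x)%:E)%E].

(* N_i. The photons of a process below are identically distributed, so this is
   N0 times the probability that any one of them reaches surface i. *)
Definition expected_number (R : realType) (M N0 : nat) (d : measure_display)
    (T : measurableType d) (X : beam R M N0 T) (i : 'I_M.+1)
    (a : 'I_M -> R) : R :=
  fine (expectation (law X a) (fun w => \sum_(k < N0) \1_(reach X k i) w)).

(* Functions of angles are total on R, but only their values for polarization
   angles in J matter. *)
Record is_photon_process (R : realType) (M N0 : nat) (d : measure_display)
    (T : measurableType d) (X : beam R M N0 T) (J : set R)
    (rhoS0 : R -> ('I_M -> R) -> R) (PT : 'I_M -> R -> R -> R)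
    (rhoC : 'I_M -> R -> R -> R -> R) : Prop := {
  rhoS0_rotation : forall x a a', J x -> rhoS0 x a = rhoS0 x a' ;
  PT_measurable : forall i b, measurable_fun J (fun x => PT i x b) ;
  PT_bounds : forall i b x, J x -> 0 <= PT i x b <= 1 ;
  rhoC_measurable : forall i b,
    measurable_fun (J `*` J) (fun z : R * R => rhoC i z.1 z.2 b) ;
  rhoC_ge0 : forall i b x y, J x -> J y -> 0 <= rhoC i x y b ;
  rhoC_total : forall i b x, J x ->
    (\int[lebesgue_measure]_(y in J) (rhoC i x y b)%:E = 1)%E ;

  reach_measurable : forall k i, measurable (reach X k i) ;
  angle_measurable : forall k i, measurable_fun (reach X k i) (angle X k i) ;
  angle_range : forall k i w, reach X k i w -> J (angle X k i w) ;
  reach_first : forall k, reach X k ord0 = setT ;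
  reach_next : forall k i, reach X k (back i) `<=` reach X k (front i) ;

  photons_independent : forall a (E : 'I_N0 -> set T),
    (forall k, history X k ord_max (E k)) ->
    law X a (\bigcap_(k in [set: 'I_N0]) E k)
    = (\prod_(k < N0) law X a (E k))%E ;

  initial_density : forall a k,
    is_angle_density X J a k ord0 (rhoS0 ^~ a) ;
  transmission : forall a k i,
    is_cond_prob (law X a) (state_events X k (front i))
      (reach X k (front i)) (reach X k (back i))
      (fun w => (PT i (angle X k (front i) w) (a i))%:E) ;
  outgoing : forall a k i (B : set R), measurable B ->
    is_cond_prob (law X a) (state_events X k (front i))
      (reach X k (back i)) (angle X k (back i) @^-1` B)
      (fun w => \int[lebesgue_measure]_(y in J `&` B)
                  (rhoC i (angle X k (front i) w) y (a i))%:E)%E ;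
  (* Given the past, transmission with outgoing angle in B has the conditional
     probability that it has given the present angle only. *)
  memoryless : forall a k i (B : set R) (g : R -> R), measurable B ->
    measurable_fun J g -> (forall x, J x -> 0 <= g x <= 1) ->
    let E := reach X k (back i) `&` angle X k (back i) @^-1` B in
    let f := fun w => (g (angle X k (front i) w))%:E in
    is_cond_prob (law X a) (state_events X k (front i))
      (reach X k (front i)) E f ->
    is_cond_prob (law X a) (history X k (front i))
      (reach X k (front i)) E f }.

Record is_case3 (R : realType) (M : nat) (J : set R)
    (PTi : 'I_M -> R -> R -> R) (rhoCi : 'I_M -> R -> R -> R -> R)
    (PT : R -> R -> R) (rhoC : R -> R -> R -> R) : Prop := {
  rhoCi_incoming : forall i x x' y b, J x -> J x' -> J y ->
    rhoCi i x y b = rhoCi i x' y b ;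
  PTi_common : forall i x b, J x -> PTi i x b = PT x b ;
  rhoCi_common : forall i x y b, J x -> J y -> rhoCi i x y b = rhoC x y b }.

(* Main.v *)
Require Import Defs.
From HB Require Import structures.
From mathcomp Require Import all_boot all_order all_algebra.
From mathcomp Require Import all_classical all_reals all_analysis.
From mathcomp Require Import measurable_realfun.
Import Order.TTheory GRing.Theory Num.Theory.
Import numFieldNormedType.Exports.
Local Open Scope classical_set_scope.
Local Open Scope ring_scope.

(** By the defining property of transmission, the probability that a photon
    reaches Sigma_(i+1) is the integral over the event of reaching Sigma_i of
    P_T at its angle.  Transferring this integral to the law of the angle,
    whose density on that event is P(reach Sigma_i) * rho_(S,i), gives
    P(reach Sigma_(i+1)) = P(reach Sigma_i) * \int rho_(S,i) P_T for every
    photon; the integral is the same for all photons, so it factors out when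
    summing over them to get the expected numbers. *)

(** A finite [nu] with density [rho] is dominated by [mu], so it has a Radon-Nikodym derivative.
    That derivative has the same integrals as [rho] over all measurable sets, hence equals it almost
    everywhere, and the change of variables for the derivative carries over to [rho]. *)
Lemma ge0_integral_density d (T : measurableType d) (R : realType)
    (mu : {sigma_finite_measure set T -> \bar R})
    (nu : {measure set T -> \bar R}) (rho f : T -> \bar R) :
  (nu setT < +oo)%E -> measurable_fun setT rho ->
  (forall x, 0 <= rho x)%E ->
  (forall A, measurable A -> nu A = \int[mu]_(x in A) rho x)%E ->
  measurable_fun setT f -> (forall x, 0 <= f x)%E ->
  (\int[nu]_x f x = \int[mu]_x (f x * rho x))%E.
Proof.
move=> nuoo mrho rho0 nuE mf f0.
(* Restricting to [setT] changes no value; it only equips [nu] with the structure of a finite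
   measure. *)
pose nu' : {finite_measure set T -> \bar R} := mfrestr measurableT nuoo.
have nu'E A : nu' A = nu A by rewrite /nu'/= /mfrestr/= /mrestr setIT.
have numu : nu' `<< mu.
  apply/null_content_dominatesP => /= A mA muA.
  rewrite nu'E nuE//; apply: null_set_integral => //.
  exact: measurable_funS mrho.
rewrite (eq_measure_integral nu'); last by move=> A mA _; apply: esym; exact: nu'E.
have RNi := Radon_Nikodym_SigmaFinite.f_integrable numu.
have mRN := measurable_int _ RNi.
rewrite -(Radon_Nikodym_SigmaFinite.change_of_variables numu)//.
have RNrho : ae_eq mu setT (Radon_Nikodym_SigmaFinite.f nu' mu) rho.
  apply: integral_ae_eq => // E _ mE.
  by rewrite -Radon_Nikodym_SigmaFinite.f_integral// nu'E nuE.
apply: ge0_ae_eq_integral => //.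
- exact: emeasurable_funM.
- exact: emeasurable_funM.
- by move=> x _; rewrite mule_ge0// Radon_Nikodym_SigmaFinite.f_ge0.
- by move=> x _; rewrite mule_ge0.
- by apply: filterS RNrho => x /= + _ => ->.
Qed.

(** The restricted measure has density [\1_D] with respect to [P]. *)
Lemma ge0_integral_mrestr d (T : measurableType d) (R : realType)
    (P : {finite_measure set T -> \bar R}) (D : set T) (mD : measurable D)
    (f : T -> \bar R) :
  measurable_fun setT f -> (forall x, 0 <= f x)%E ->
  (\int[mrestr P mD]_x f x = \int[P]_(x in D) f x)%E.
Proof.
move=> mf f0.
rewrite (@ge0_integral_density _ _ _ P _ (fun x => (\1_D x)%:E))//.
- rewrite [RHS]integral_mkcond; apply: eq_integral => x _.
  by rewrite epatch_indic.
- by rewrite /= /mrestr setTI -ge0_fin_numE// fin_num_measure.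
- by apply/measurable_EFinP; exact: measurable_indic.
- by move=> A mA; rewrite integral_indic// /= /mrestr setIC.
Qed.

Lemma expected_numberE (R : realType) (M N0 : nat) d (T : measurableType d)
    (X : beam R M N0 T) (i : 'I_M.+1) (a : 'I_M -> R) :
  (forall k, measurable (reach X k i)) ->
  expected_number X i a = \sum_(k < N0) fine (law X a (reach X k i)).
Proof.
move=> mreach; rewrite /expected_number unlock.
under eq_integral do rewrite -sumEFin.
rewrite ge0_integral_sum//.
- under eq_bigr => k _ do rewrite integral_indic// setIT.
  by rewrite sum_fine// => k _; rewrite fin_num_measure.
- by move=> k; apply/measurable_EFinP; exact: measurable_indic.
Qed.

(** The integral is transferred to the line by pushing [P], restricted to the event of reaching the
    surface, forward along the angle. This image measure has total mass equal to the probability of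
    that event. *)
Lemma integral_angle_density (R : realType) (M N0 : nat) d
    (T : measurableType d) (X : beam R M N0 T) (J : set R) (a : 'I_M -> R)
    (k : 'I_N0) (i : 'I_M.+1) (rho g : R -> R) :
  measurable J -> measurable (reach X k i) ->
  measurable_fun (reach X k i) (angle X k i) ->
  (forall w, reach X k i w -> J (angle X k i w)) ->
  is_angle_density X J a k i rho -> law X a (reach X k i) != 0%E ->
  measurable_fun J g -> (forall x, J x -> 0 <= g x) ->
  (\int[law X a]_(w in reach X k i) (g (angle X k i w))%:E =
   law X a (reach X k i) * \int[lebesgue_measure]_(x in J) (rho x * g x)%:E)%E.
Proof.
move=> mJ mD mangle angleJ rhoP p0 mg g0.
have [mrho rho0 rhoE] := rhoP p0.
set D := reach X k i in mD mangle angleJ p0 rhoE *.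
pose P := law X a; rewrite -/P in rhoE p0 *.
(* The default value of [phi] off [D] is harmless, since [mrestr P mD] gives no mass to the
   complement of [D]. *)
pose phi : T -> measurableTypeR R := angle X k i \_ D.
have mphi : measurable_fun setT phi by apply/(measurable_restrictT _ mD).
pose G := EFin \o (g \_ J).
have mG : measurable_fun setT G.
  by apply/measurable_EFinP; apply/(measurable_restrictT _ mJ).
have G0 x : (0 <= G x)%E.
  by rewrite lee_fin patchE; case: ifPn => // /[!inE]; exact: g0.
(* The density [rho] is conditioned on reaching the surface; the factor [fine (P D)] undoes this
   normalization, and [rho] is extended by zero outside [J]. *)
pose r := EFin \o (fun x => fine (P D) * (rho \_ J) x).
have PD0 : 0 <= fine (P D) by rewrite fine_ge0.
have rhoJ0 x : 0 <= (rho \_ J) x.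
  by rewrite patchE; case: ifPn => // /[!inE]; exact: rho0.
have mrhoJ : measurable_fun setT (rho \_ J).
  by apply/(measurable_restrictT _ mJ).
have mr : measurable_fun setT r.
  by apply/measurable_EFinP; exact: measurable_funM.
have r0 x : (0 <= r x)%E by rewrite lee_fin mulr_ge0.
have PDfin : fine (P D) != 0 by rewrite fine_eq0// fin_num_measure.
transitivity (\int[mrestr P mD]_w G (phi w))%E.
  rewrite ge0_integral_mrestr//; last exact: measurableT_comp.
  apply: eq_integral => w /[!inE] Dw.
  rewrite /phi patchE mem_set // /G /= patchE mem_set//; exact: angleJ.
have := @ge0_integral_pushforward _ _ _ _ R _ mphi (mrestr P mD) setT G
  measurableT mG.
rewrite preimage_setT => <-; last by move=> x _; exact: G0.
rewrite (@ge0_integral_density _ _ _ lebesgue_measure _ r)//.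
- rewrite -[P D in RHS]fineK ?fin_num_measure//.
  rewrite -ge0_integralZl//.
  + rewrite [RHS]integral_mkcond; apply: eq_integral => x _.
    rewrite /G /r /= !patchE; case: ifPn => xJ; last by rewrite mul0e.
    by rewrite -!EFinM mulrC mulrA.
  + by apply/measurable_EFinP; exact: measurable_funM.
  + by move=> x Jx; rewrite lee_fin mulr_ge0 ?rho0 ?g0.
- rewrite /= /pushforward /mrestr.
  by rewrite preimage_setT setTI (le_lt_trans (probability_le1 _ mD))// ltry.
(* It remains to check that [r] is the density of the image measure: this is the quotient formula
   [rhoE] multiplied by the nonzero number [fine (P D)]. *)
- move=> B mB.
  transitivity (P (D `&` angle X k i @^-1` B)).
    rewrite /= /pushforward /mrestr; congr (P _); apply/seteqP; split => w /=.
      by move=> [+ Dw]; rewrite /phi patchE mem_set.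
    by move=> [Dw Bw]; rewrite /phi patchE mem_set.
  have mDB : measurable (D `&` angle X k i @^-1` B) by exact: mangle.
  rewrite -[LHS]fineK ?fin_num_measure//.
  under eq_integral do rewrite /r /= EFinM.
  rewrite ge0_integralZl//.
  + rewrite (_ : \int[_]_(x in B) _ =
        \int[lebesgue_measure]_(x in J `&` B) (rho x)%:E)%E; last first.
      rewrite setIC [RHS]integral_mkcondr; apply: eq_integral => x _.
      by rewrite !patchE; case: ifP.
    by rewrite -rhoE// -EFinM mulrC divfK.
  + by apply/measurable_EFinP; exact: measurable_funTS.
  + by move=> x _; rewrite lee_fin.
Qed.

(** In [transmission] the event of the past is taken to be reaching the front surface itself; it
    contains the event of reaching the back surface, so the intersections collapse. *)
Lemma law_reach_back (R : realType) (M N0 : nat) d (T : measurableType d)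
    (X : beam R M N0 T) (J : set R) rhoS0 PTi rhoCi
    (hX : is_photon_process X J rhoS0 PTi rhoCi) (a : 'I_M -> R)
    (k : 'I_N0) (i : 'I_M) :
  law X a (reach X k (back i)) =
  (\int[law X a]_(w in reach X k (front i))
     (PTi i (angle X k (front i) w) (a i))%:E)%E.
Proof.
have reachA : state_events X k (front i) (reach X k (front i)).
  by exists setT; [exact: measurableT|rewrite preimage_setT setIT].
have := transmission hX a reachA; rewrite !setIid => <-.
by congr (law X a _); apply/esym/setIidr; exact: reach_next hX k i.
Qed.

Arguments law_reach_back {R M N0 d T X J rhoS0 PTi rhoCi} hX a k i.

Theorem mainTheorem8 (R : realType) (M N0 : nat) (hM : (1 <= M)%N)
    (hN0 : (0 < N0)%N) (d : measure_display) (T : measurableType d)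
    (I : interval R) (hI : lebesgue_measure [set` I] = (2 * pi)%:E)
    (X : beam R M N0 T)
    (rhoS0 : R -> ('I_M -> R) -> R)
    (PTi : 'I_M -> R -> R -> R) (rhoCi : 'I_M -> R -> R -> R -> R)
    (hX : is_photon_process X [set` I] rhoS0 PTi rhoCi)
    (PT : R -> R -> R) (rhoC : R -> R -> R -> R)
    (h3 : is_case3 [set` I] PTi rhoCi PT rhoC)
    (rhoS : 'I_M.+1 -> R -> ('I_M -> R) -> R)
    (hS : forall (a : 'I_M -> R) (k : 'I_N0) (i : 'I_M.+1),
       is_angle_density X [set` I] a k i (rhoS i ^~ a))
    (a : 'I_M -> R) (i : 'I_M) :
  (expected_number X (back i) a / N0%:R)%:E =
  (\int[lebesgue_measure]_(x in [set` I])
     (expected_number X (front i) a / N0%:R * rhoS (front i) x a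
      * PT x (a i))%:E)%E.
Proof.
have mreach j k : measurable (reach X k j) := reach_measurable hX k j.
have mJ : measurable [set` I] by exact: measurable_itv.
have mPT := PT_measurable hX i (a i).
have PT0 x : [set` I] x -> 0 <= PTi i x (a i).
  by move=> Jx; have /andP[] := PT_bounds hX i (a i) Jx.
(* The same [c] serves every photon, because [rhoS] is a common density for all of them. *)
pose c := (\int[lebesgue_measure]_(x in [set` I])
  (rhoS (front i) x a * PTi i x (a i))%:E)%E.
have step k : law X a (reach X k (front i)) != 0%E ->
    law X a (reach X k (back i)) = (law X a (reach X k (front i)) * c)%E.
  move=> p0; rewrite (law_reach_back hX).
  apply: (@integral_angle_density _ _ _ _ _ X [set` I] a k (front i) _
    (fun x => PTi i x (a i))) => //.
  - exact: angle_measurable hX k (front i).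
  - by move=> w; exact: (angle_range hX).
have lawK k j : (fine (law X a (reach X k j)))%:E = law X a (reach X k j).
  by rewrite fineK// fin_num_measure.
rewrite !expected_numberE//.
(* If no photon reaches the surface, rhoS is unconstrained and may even be
   non-measurable, so this case is treated apart. *)
have [all0|/existsNP[k0 /eqP p0]] :=
    pselect (forall k, law X a (reach X k (front i)) = 0%E).
  rewrite !big1; last 2 first.
  - by move=> k _; rewrite all0.
  - move=> k _; rewrite (_ : law _ _ _ = 0%E)//.
    apply: subset_measure0 (all0 k) => //.
    exact: reach_next hX k i.
  by rewrite mul0r integral0_eq// => x _; rewrite !mul0r.
have [mrho rho0 _] := hS a k0 (front i) p0.
(* For a photon [k0] with positive probability [p] of reaching the front surface, [p * c] is a
   probability; an infinite [c] would make it infinite. *)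
have cfin : c \is a fin_num.
  have p_gt0 : (0 < law X a (reach X k0 (front i)))%E.
    by rewrite lt0e p0 measure_ge0.
  have := step k0 p0; rewrite -(lawK k0 (back i)).
  have c0 : (0 <= c)%E.
    by apply: integral_ge0 => x Jx; rewrite lee_fin mulr_ge0 ?rho0 ?PT0.
  rewrite ge0_fin_numE// ltey; apply: contra_eqN => /eqP ->.
  by rewrite gt0_muley.
(* The relation extends to photons that almost surely miss the front surface: both sides are then
   zero. *)
have stepc k : fine (law X a (reach X k (back i))) =
    fine (law X a (reach X k (front i))) * fine c.
  have [p00|pn0] := eqVneq (law X a (reach X k (front i))) 0%E.
    rewrite p00 mul0r (_ : law _ _ _ = 0%E)//.
    apply: subset_measure0 p00 => //.
    exact: reach_next hX k i.
  by rewrite step// fineM// fin_num_measure.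
under eq_bigr do rewrite stepc.
(* The common factor [c] leaves the sum, the remaining ratio of expected numbers enters the
   integral, and [PTi] becomes [PT] since the elements are identical. *)
rewrite -mulr_suml mulrAC EFinM fineK// /c -ge0_integralZl//.
- apply: eq_integral => x /[!inE] Jx.
  by rewrite -EFinM mulrA (PTi_common h3).
- by apply/measurable_EFinP; exact: measurable_funM.
- by move=> x Jx; rewrite lee_fin mulr_ge0 ?rho0 ?PT0.
- by rewrite lee_fin divr_ge0// sumr_ge0// => k _; rewrite fine_ge0.
Qed.
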